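(* For every $t>t_0$ and $x,x_0\in\mathbb{R}^N$, $$\nu^{N}\,\Gamma_{\nu}(x,t;x_0,t_0)\le\Gamma(x,t;x_0,t_0)\le\frac{1}{\nu^{N}}\,\Gamma_{\nu^{-1}}(x,t;x_0,t_0).$$
   Context: Standing assumptions. (H1) $A_0(t)=\{a_{ij}(t)\}_{i,j=1}^q$, $1\le q\le N$, is a symmetric matrix of bounded measurable functions of $t\in\mathbb{R}$ such that, for some constant $\nu>0$, $\nu|\xi|^2\le\sum_{i,j=1}^q a_{ij}(t)\xi_i\xi_j\le\nu^{-1}|\xi|^2$ for every $\xi\in\mathbb{R}^q$ and a.e. $t\in\mathbb{R}$. (H2) $B=\{b_{ij}\}_{i,j=1}^N$ is a constant real matrix such that, for $m_0=q$ and suitable positive integers $m_1,\dots,m_\kappa$ with $m_0\ge m_1\ge\dots\ge m_\kappa\ge1$ and $m_0+m_1+\dots+m_\kappa=N$, $$B=\begin{bmatrix}*&*&\ldots&*&*\\ B_1&*&\ldots&*&*\\ 0&B_2&\ldots&*&*\\ \vdots&\vdots&\ddots&\vdots&\vdots\\ 0&0&\ldots&B_\kappa&*\end{bmatrix}$$ where each $B_j$ is an $m_j\times m_{j-1}$ block of rank $m_j$ ($j=1,\dots,\kappa$) and the blocks $*$ are arbitrary. Notation: vectors are columns; $A(t)=\begin{bmatrix}A_0(t)&0\\0&0\end{bmatrix}$ ($N\times N$); $E(s)=\exp(-sB)$; for $t>t_0$, $C(t,t_0)=\int_{t_0}^tE(t-\sigma)A(\sigma)E(t-\sigma)^Td\sigma$,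 which is symmetric positive definite. The function $\Gamma$ (the fundamental solution of $\mathcal{L}u=\sum_{i,j=1}^{q}a_{ij}(t)\partial^2_{x_ix_j}u+\sum_{k,j=1}^{N}b_{jk}x_k\partial_{x_j}u-\partial_tu$) is, for $t>t_0$, $$\Gamma(x,t;x_0,t_0)=\frac{1}{(4\pi)^{N/2}\sqrt{\det C(t,t_0)}}\,\exp\Big(-\tfrac14(x-E(t-t_0)x_0)^{T}C(t,t_0)^{-1}(x-E(t-t_0)x_0)-(t-t_0)\operatorname{Tr}B\Big).$$ For a constant $\alpha>0$, $\Gamma_\alpha$ is the corresponding function for the model operator $\mathcal{L}_\alpha u=\alpha\sum_{i=1}^q\partial^2_{x_ix_i}u+\sum_{k,j=1}^Nb_{jk}x_k\partial_{x_j}u-\partial_tu$ (same $B$), namely, for $t>t_0$, $\Gamma_\alpha(x,t;x_0,t_0)=\Gamma_\alpha(x-E(t-t_0)x_0,t-t_0;0,0)$ with $$\Gamma_\alpha(x,t;0,0)=\frac{1}{(4\pi\alpha)^{N/2}\sqrt{\det C_0(t)}}\exp\Big(-\frac{1}{4\alpha}x^TC_0(t)^{-1}x-t\operatorname{Tr}B\Big)\quad(t>0),$$ $$C_0(t)=\int_0^tE(t-\sigma)I_{q,N}E(t-\sigma)^Td\sigma,\qquad I_{q,N}=\begin{bmatrix}I_q&0\\0&0\end{bmatrix},$$ where $C_0(t)$ is positive definite for $t>0$. The constant $\nu$ in the claim is the one in (H1). *)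

(* Defs.v *)
From HB Require Import structures.
From mathcomp Require Import all_boot all_order all_algebra.
From mathcomp Require Import all_classical all_reals all_analysis.

Set Implicit Arguments.
Unset Strict Implicit.
Unset Printing Implicit Defensive.
Import Order.TTheory GRing.Theory Num.Theory.
Import numFieldNormedType.Exports.

Local Open Scope classical_set_scope.
Local Open Scope ring_scope.

(* The real line with the Lebesgue (completed Borel) sigma-algebra, on which
   completed_lebesgue_measure is defined; the library's default measurable
   structure on R is the Borel one, and lebesgue_measure lives on it. *)
Notation lebesgueR R :=
  (caratheodory_type
    (mu_ext (@wlength R idfun) : set (ocitv_type R) -> \bar R)).

(* The topology on matrices is that of the sup norm of the entries. *)
Definition expmx (R : realType) (N : nat) (M : 'M[R]_N) : 'M[R]_N :=
  limn (series (fun k : nat => (k`!%:R)^-1 *: M ^+ k)).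

Definition integralmx (R : realType) (m n : nat) (D : set (lebesgueR R))
    (F : R -> 'M[R]_(m, n)) : 'M[R]_(m, n) :=
  \matrix_(i, j) \int[completed_lebesgue_measure]_(s in D) F s i j.

Definition elliptic_coeffs (R : realType) (q : nat) (nu : R)
    (A0 : R -> 'M[R]_q) : Prop :=
  [/\ forall t, (A0 t)^T = A0 t,
      forall i j, measurable_fun [set: lebesgueR R]
                    (fun t : lebesgueR R => A0 t i j),
      exists K : R, forall t i j, `|A0 t i j| <= K,
      0 < nu
    & forall xi : 'cV[R]_q,
        {ae completed_lebesgue_measure, forall t : lebesgueR R,
          nu * (\sum_i xi i 0 ^+ 2)
            <= \sum_i \sum_j A0 t i j * xi i 0 * xi j 0
            <= nu^-1 * (\sum_i xi i 0 ^+ 2)}].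

(* The cast only identifies 'M_N with 'M_(\sum_i m i), on which submxblock _ i j
   extracts the m i x m j block in block row i and block column j. *)
Definition block_structure (R : realType) (q N : nat) (B : 'M[R]_N) : Prop :=
  exists (kappa : nat) (m : 'I_kappa.+1 -> nat) (hN : (\sum_i m i)%N = N),
    let blk i j := submxblock (castmx (esym hN, esym hN) B) i j in
    [/\ m ord0 = q,
        forall i j : 'I_kappa.+1, (i <= j)%N -> (m j <= m i)%N,
        forall i, (0 < m i)%N,
        forall i j : 'I_kappa.+1, (j.+1 < i)%N -> blk i j = 0
      & forall i j : 'I_kappa.+1, i = j.+1 :> nat -> \rank (blk i j) = m i].

(* The dimension N is written q + r with 0 <= r, so that the first q coordinates
   are the leading block of the library's block matrices. *)
Definition extmx (R : realType) (q r : nat) (A0 : 'M[R]_q) : 'M[R]_(q + r) :=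
  block_mx A0 0 0 0.

Definition Emx (R : realType) (N : nat) (B : 'M[R]_N) (s : R) : 'M[R]_N :=
  expmx (- s *: B).

Definition Cmx (R : realType) (q r : nat) (A0 : R -> 'M[R]_q)
    (B : 'M[R]_(q + r)) (t t0 : R) : 'M[R]_(q + r) :=
  integralmx `[t0, t]
    (fun s => Emx B (t - s) *m extmx r (A0 s) *m (Emx B (t - s))^T).

Definition C0mx (R : realType) (q r : nat) (B : 'M[R]_(q + r)) (t : R) :
    'M[R]_(q + r) :=
  integralmx `[0, t]
    (fun s => Emx B (t - s) *m extmx r (1%:M : 'M[R]_q) *m (Emx B (t - s))^T).

Definition quadform (R : realType) (N : nat) (M : 'M[R]_N) (x : 'cV[R]_N) : R :=
  (x^T *m M *m x) 0 0.

(* Gamma, Gamma_alpha0 and Gamma_alpha are only meaningful for t0 < t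
   (resp. 0 < t). *)
Definition Gamma (R : realType) (q r : nat) (A0 : R -> 'M[R]_q)
    (B : 'M[R]_(q + r)) (x : 'cV[R]_(q + r)) (t : R)
    (x0 : 'cV[R]_(q + r)) (t0 : R) : R :=
  1 / ((4 * pi) `^ ((q + r)%:R / 2) * Num.sqrt (\det (Cmx A0 B t t0)))
  * expR (- (1 / 4) * quadform (invmx (Cmx A0 B t t0)) (x - Emx B (t - t0) *m x0)
          - (t - t0) * \tr B).

Definition Gamma_alpha0 (R : realType) (q r : nat) (alpha : R)
    (B : 'M[R]_(q + r)) (x : 'cV[R]_(q + r)) (t : R) : R :=
  1 / ((4 * pi * alpha) `^ ((q + r)%:R / 2) * Num.sqrt (\det (C0mx B t)))
  * expR (- (1 / (4 * alpha)) * quadform (invmx (C0mx B t)) x - t * \tr B).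

Definition Gamma_alpha (R : realType) (q r : nat) (alpha : R)
    (B : 'M[R]_(q + r)) (x : 'cV[R]_(q + r)) (t : R)
    (x0 : 'cV[R]_(q + r)) (t0 : R) : R :=
  Gamma_alpha0 alpha B (x - Emx B (t - t0) *m x0) (t - t0).

(* Main.v *)
Require Import Defs.
From HB Require Import structures.
From mathcomp Require Import all_boot all_order all_algebra.
From mathcomp Require Import all_classical all_reals all_analysis.
From mathcomp Require Import measurable_realfun.
From mathcomp Require Import ring lra.
Import Order.TTheory GRing.Theory Num.Theory.
Import numFieldNormedType.Exports.
Set Implicit Arguments.
Unset Strict Implicit.
Local Open Scope classical_set_scope.
Local Open Scope ring_scope.

(** Everything follows from one comparison in the Loewner order (the pointwise
order of quadratic forms): writing [C0] for the covariance matrix of the model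
operator at time [t - t0] and [C] for that of the operator itself,
  [nu C0 <= C <= nu^-1 C0]   ([loewner_le_Cmx]).
It holds because the integrand of [x^T C x] at time [s] is the form [A0 s]
evaluated at the first [q] coordinates of [E(t - s)^T x], and ellipticity
compares [A0 s] with the identity for almost every [s]; the integral with the
identity in place of [A0] is [C0], up to a translation of the time variable.

Given the comparison, the two bounds of the theorem are the same computation
([gaussian_le]).  On positive semidefinite matrices the determinant is monotone
([det_loewner]) and inversion is antitone ([quadform_invmx_le]).  The lower
bound uses [det C <= nu^-N det C0] for the prefactors and
[C^-1 <= nu^-1 C0^-1] for the exponents; the upper bound uses the two reversed
comparisons.  The powers of [nu] match because
[nu^N / nu^(N/2) = nu^(N/2)].  The comparison also makes [det C] and [det C0]
vanish together: then all three members of the theorem are zero, the division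
[1 / 0] being [0], and otherwise both matrices are invertible.

Three analytic points need care.
- The ellipticity hypothesis provides an exceptional null set for each vector
  [xi], whereas it is applied to a vector that depends on the time [s].  Integer
  vectors are countably many, and by homogeneity and continuity they determine
  the order between two forms ([loewner_le_int]), so that one null set serves
  all vectors ([elliptic_coeffs_loewner]).
- The entries of [E(t - s)] must be measurable and bounded for the integrals to
  be linear and monotone.  They are pointwise limits of polynomials in the time
  variable, dominated by a scalar exponential ([bounded_measurable_Emx]).
- The translation of the time variable is an image-measure argument, based on
  the uniqueness of Lebesgue measure ([pushforward_translation]). *)

(** * Quadratic forms and the Loewner order *)

Definition psdmx {R : realType} {n : nat} (M : 'M[R]_n) : Prop :=
  forall x, 0 <= quadform M x.

Definition loewner_le {R : realType} {n : nat} (M M' : 'M[R]_n) : Prop :=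
  forall x, quadform M x <= quadform M' x.

Lemma quadformZ {R : realType} {n : nat} (a : R) (M : 'M[R]_n) x :
  quadform (a *: M) x = a * quadform M x.
Proof. by rewrite /quadform -scalemxAr -scalemxAl mxE. Qed.

Lemma quadformB {R : realType} {n : nat} (M M' : 'M[R]_n) x :
  quadform (M - M') x = quadform M x - quadform M' x.
Proof. by rewrite /quadform mulmxBr mulmxBl !mxE. Qed.

Lemma quadform_sum {R : realType} {n : nat} (M : 'M[R]_n) (x : 'cV[R]_n) :
  quadform M x = \sum_i \sum_j M i j * x i 0 * x j 0.
Proof.
rewrite /quadform mxE exchange_big; apply: eq_bigr => j _.
rewrite mxE big_distrl; apply: eq_bigr => i _ /=.
by rewrite !mxE [x i 0 * _]mulrC.
Qed.

Lemma psdmx_le {R : realType} {n : nat} (M M' : 'M[R]_n) :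
  psdmx M -> loewner_le M M' -> psdmx M'.
Proof. by move=> M0 MM' x; apply: le_trans (M0 x) (MM' x). Qed.

Lemma quadform_scale {R : realType} {n : nat} (M : 'M[R]_n) (a : R)
    (x : 'cV[R]_n) : quadform M (a *: x) = a ^+ 2 * quadform M x.
Proof.
rewrite !quadform_sum mulr_sumr; apply: eq_bigr => i _.
by rewrite mulr_sumr; apply: eq_bigr => j _; rewrite !mxE; ring.
Qed.

Lemma quadform1_ge0 {R : realType} {n : nat} (x : 'cV[R]_n) :
  0 <= quadform 1%:M x.
Proof.
rewrite /quadform mulmx1 mxE; apply: sumr_ge0 => i _.
by rewrite mxE -expr2 sqr_ge0.
Qed.

Lemma quadform_congr {R : realType} {m : nat} (P M : 'M[R]_m)
    (x : 'cV[R]_m) : quadform (P *m M *m P^T) x = quadform M (P^T *m x).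
Proof. by rewrite /quadform trmx_mul trmxK !mulmxA. Qed.

Lemma quadform_extmx {R : realType} {q r : nat} (A : 'M[R]_q)
    (x : 'cV[R]_(q + r)) : quadform (extmx r A) x = quadform A (usubmx x).
Proof.
rewrite /quadform /extmx -[x in LHS]vsubmxK tr_col_mx mul_row_block.
by rewrite !mulmx0 !addr0 mul_row_col mul0mx addr0.
Qed.

(** * Monotonicity of the determinant and of the inverse *)

Definition bordermx {R : realType} {n : nat} (a : R) (b : 'rV[R]_n)
    (D : 'M[R]_n) : 'M[R]_(1 + n) := block_mx a%:M b b^T D.

Definition schur_complement {R : realType} {n : nat} (a : R) (b : 'rV[R]_n)
    (D : 'M[R]_n) : 'M[R]_n := D - a^-1 *: (b^T *m b).

Lemma symmetric_bordermx {R : realType} {n : nat} (M : 'M[R]_(1 + n)) :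
  M^T = M -> exists a b D, D^T = D /\ M = bordermx a b D.
Proof.
move=> MT; exists (M 0 0), (ursubmx M), (drsubmx M); split.
  by rewrite trmx_drsub MT.
rewrite /bordermx trmx_ursub MT -[LHS]submxK; congr block_mx.
apply/matrixP => i j; rewrite !mxE !ord1 eqxx mulr1n.
by congr (M _ _); apply/val_inj.
Qed.

Lemma quadform_bordermx {R : realType} {n : nat} (a : R) (b : 'rV[R]_n)
    (D : 'M[R]_n) (c : R) (y : 'cV[R]_n) :
  quadform (bordermx a b D) (col_mx c%:M y)
  = a * c ^+ 2 + 2 * c * (b *m y) 0 0 + quadform D y.
Proof.
rewrite /quadform /bordermx tr_col_mx tr_scalar_mx mul_row_block mul_row_col.
have -> : y^T *m b^T = (b *m y)^T by rewrite trmx_mul.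
rewrite !mulmxDl !mul_scalar_mx -!scalemxAl !mul_mx_scalar !mxE !eqxx !mulr1n.
ring.
Qed.

(** For [0 < a], the form of the Schur complement is the minimum over
[c] of the form of the bordered matrix at [(c, y)], attained at [c = - a^-1 (b y)]. *)
Lemma quadform_schur_complement {R : realType} {n : nat} (a : R) (b : 'rV[R]_n)
    (D : 'M[R]_n) (y : 'cV[R]_n) :
  quadform (schur_complement a b D) y = quadform D y - a^-1 * (b *m y) 0 0 ^+ 2.
Proof.
rewrite quadformB quadformZ; congr (_ - _ * _).
rewrite /quadform mulmxA -mulmxA -trmx_mul mxE big_ord1 mxE expr2.
by [].
Qed.

(** A minimum over [c] is monotone in the function that is minimized.  The proof
compares the two bordered forms at the minimizer [c] of the larger one. *)
Lemma schur_complement_le {R : realType} {n : nat} (a a' : R) (b b' : 'rV[R]_n)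
    (D D' : 'M[R]_n) : 0 < a -> 0 < a' ->
  loewner_le (bordermx a b D) (bordermx a' b' D') ->
  loewner_le (schur_complement a b D) (schur_complement a' b' D').
Proof.
move=> a_gt0 a'_gt0 le_bor y.
pose c := - (a'^-1 * (b' *m y) 0 0).
have := le_bor (col_mx c%:M y).
rewrite !quadform_bordermx !quadform_schur_complement.
set u := (b *m y) 0 0; set v := (b' *m y) 0 0 in c *.
have -> : a' * c ^+ 2 + 2 * c * v = - (a'^-1 * v ^+ 2).
  by rewrite /c -/v; field; rewrite gt_eqF.
have -> : a * c ^+ 2 + 2 * c * u = a * (c + a^-1 * u) ^+ 2 - a^-1 * u ^+ 2.
  by field; rewrite gt_eqF.
have : 0 <= a * (c + a^-1 * u) ^+ 2 by rewrite mulr_ge0 ?sqr_ge0 ?ltW.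
lra.
Qed.

(** One step of Gaussian elimination, which does not change the determinant. *)
Lemma det_bordermx {R : realType} {n : nat} (a : R) (b : 'rV[R]_n)
    (D : 'M[R]_n) : a != 0 ->
  \det (bordermx a b D) = a * \det (schur_complement a b D).
Proof.
move=> a0.
have /(congr1 determinant) :
    block_mx 1%:M 0 (- (a^-1 *: b^T)) 1%:M *m bordermx a b D
    = block_mx a%:M b 0 (schur_complement a b D).
  rewrite /bordermx mulmx_block !mul1mx !mul0mx !addr0 mulNmx mul_mx_scalar.
  rewrite scalerA divff// scale1r addNr; congr block_mx.
  by rewrite mulNmx -scalemxAl addrC.
by rewrite det_mulmx det_lblock !det1 !mul1r det_ublock det_scalar1.
Qed.

Lemma quadform_bordermx_corner {R : realType} {n : nat} (a : R) (b : 'rV[R]_n)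
    (D : 'M[R]_n) : quadform (bordermx a b D) (col_mx 1%:M 0) = a.
Proof.
rewrite quadform_bordermx mulmx0 mxE expr1n !mulr1 mulr0 addr0.
by rewrite /quadform mulmx0 mxE addr0.
Qed.

(** A vanishing diagonal entry of a semidefinite matrix forces its row to vanish:
at [(c, b^T)] the form is affine in [c] with slope [2 b b^T], so it would take
negative values if [b] were nonzero. *)
Lemma psd_bordermx0 {R : realType} {n : nat} (b : 'rV[R]_n)
    (D : 'M[R]_n) : psdmx (bordermx 0 b D) -> \det (bordermx 0 b D) = 0.
Proof.
move=> M0.
suff b0 : b = 0.
  by rewrite /bordermx b0 det_lblock det_scalar1 mul0r.
pose s := \sum_j b 0 j ^+ 2; pose K := quadform D b^T.
have sE : (b *m b^T) 0 0 = s.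
  by rewrite mxE; apply: eq_bigr => j _; rewrite mxE expr2.
have s0 : s = 0.
  apply/eqP/negP => /negP s0.
  (* this value of [c] makes the form at [(c, b^T)] equal to [-1] *)
  have := M0 (col_mx (- ((K + 1) / (2 * s)))%:M b^T).
  rewrite quadform_bordermx sE -/K mul0r add0r.
  have -> : 2 * - ((K + 1) / (2 * s)) * s = - (K + 1) by field.
  lra.
apply/rowP => j; rewrite mxE; apply/eqP.
rewrite -sqrf_eq0; move/eqP: s0; rewrite psumr_eq0; last first.
  by move=> ? _; exact: sqr_ge0.
by move=> /allP /(_ j); rewrite mem_index_enum => /(_ isT).
Qed.

Lemma psd_schur_complement {R : realType} {n : nat} (a : R) (b : 'rV[R]_n)
    (D : 'M[R]_n) : 0 < a ->
  psdmx (bordermx a b D) -> psdmx (schur_complement a b D).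
Proof.
move=> a_gt0 M0 y.
have := M0 (col_mx (- (a^-1 * (b *m y) 0 0))%:M y).
rewrite quadform_bordermx quadform_schur_complement; set u := (b *m y) 0 0.
suff -> : a * (- (a^-1 * u)) ^+ 2 + 2 * - (a^-1 * u) * u = - (a^-1 * u ^+ 2).
  by rewrite addrC.
by field; rewrite gt_eqF.
Qed.

Lemma tr_schur_complement {R : realType} {n : nat} (a : R) (b : 'rV[R]_n)
    (D : 'M[R]_n) : D^T = D ->
  (schur_complement a b D)^T = schur_complement a b D.
Proof.
by move=> DT; rewrite /schur_complement raddfB /= linearZ /= trmx_mul trmxK DT.
Qed.

(** Induction on the size: the determinant is the corner entry times the
determinant of the Schur complement, and both factors are monotone.  When a
corner entry is zero, so is the determinant. *)
Lemma det_loewner {R : realType} {n : nat} (M M' : 'M[R]_n) :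
  M^T = M -> M'^T = M' -> psdmx M -> loewner_le M M' ->
  0 <= \det M <= \det M'.
Proof.
elim: n M M' => [|n IHn] M M' MT M'T M0 MM'.
  by rewrite !det_mx00 lexx ler01.
have M'0 := psdmx_le M0 MM'.
case: (symmetric_bordermx MT) => a [b [D [DT ME]]].
case: (symmetric_bordermx M'T) => a' [b' [D' [D'T M'E]]].
subst M M'.
have a0 : 0 <= a by rewrite -(quadform_bordermx_corner a b D); exact: M0.
have a'0 : 0 <= a' by rewrite -(quadform_bordermx_corner a' b' D'); exact: M'0.
have aa' : a <= a'.
  rewrite -(quadform_bordermx_corner a b D).
  rewrite -(quadform_bordermx_corner a' b' D').
  exact: MM'.
have det_ge0 : 0 <= \det (bordermx a' b' D').
  have [a'_gt0|] := ltP 0 a'; last first.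
    move=> a'_le0; have a'E : a' = 0 by apply/le_anti/andP.
    by rewrite a'E in M'0 *; rewrite psd_bordermx0.
  rewrite det_bordermx ?gt_eqF// mulr_ge0//.
  have ST := tr_schur_complement a' b' D'T.
  by case/andP: (IHn _ _ ST ST (psd_schur_complement a'_gt0 M'0) (fun=> lexx _)).
have [a_gt0|] := ltP 0 a; last first.
  move=> a_le0; have aE : a = 0 by apply/le_anti/andP.
  by rewrite aE in M0 *; rewrite psd_bordermx0// lexx.
have a'_gt0 := lt_le_trans a_gt0 aa'.
rewrite !det_bordermx ?gt_eqF//.
have /andP[d0 dd'] := IHn _ _ (tr_schur_complement a b DT)
  (tr_schur_complement a' b' D'T)
  (psd_schur_complement a_gt0 M0)
  (schur_complement_le a_gt0 a'_gt0 MM').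
by rewrite mulr_ge0//= ler_pM.
Qed.

(** The form of [M'^-1] at [x] is the maximum over [z] of [2 x^T z - z^T M' z],
attained at [z = M'^-1 x], and this function of [z] decreases when [M'] grows.
Explicitly, the form of [M] at [y = z - M^-1 x] is nonnegative and expands into
the inequality. *)
Lemma quadform_invmx_le {R : realType} {n : nat} (M M' : 'M[R]_n) :
  M^T = M -> M'^T = M' -> M \in unitmx -> M' \in unitmx -> psdmx M ->
  loewner_le M M' -> loewner_le (invmx M') (invmx M).
Proof.
move=> MT M'T Mu M'u M0 MM' x.
pose z := invmx M' *m x; pose y := z - invmx M *m x.
have iMT : (invmx M)^T = invmx M by rewrite trmx_inv MT.
have iM'T : (invmx M')^T = invmx M' by rewrite trmx_inv M'T.
have qz : quadform (invmx M') x = quadform M' z.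
  by rewrite /quadform /z trmx_mul iM'T mulmxA mulmxKV// mulmxA.
have qy : quadform M y =
    quadform M z - 2 * quadform (invmx M') x + quadform (invmx M) x.
  have zT : z^T = x^T *m invmx M' by rewrite /z trmx_mul iM'T.
  have yT : y^T = z^T - x^T *m invmx M.
    by rewrite -[in RHS]iMT -trmx_mul -raddfB.
  have e1 : z^T *m M *m (invmx M *m x) = z^T *m x by rewrite mulmxA mulmxK.
  have e2 : x^T *m z = z^T *m x by rewrite zT -mulmxA.
  have e3 : x^T *m (invmx M *m x) = x^T *m invmx M *m x by rewrite mulmxA.
  rewrite /quadform yT !mulmxBl mulmxKV// /y !mulmxBr e1 e2 e3 -zT.
  rewrite !mxE; ring.
have := M0 y; rewrite qy.
have := MM' z; rewrite -qz; lra.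
Qed.

(** * Integer vectors determine the Loewner order *)

Lemma cvg_floor_rescale {R : realType} (x : R) :
  (n.+1%:R)^-1 * (Num.floor (n.+1%:R * x))%:~R @[n --> \oo] --> x.
Proof.
apply: (@squeeze_cvgr _ _ _ _ (fun n => x - n.+1%:R^-1) (fun=> x)).
- apply: nearW => n.
  have /andP[fl fr] := floor_itv (n.+1%:R * x).
  have n0 : 0 < n.+1%:R :> R by [].
  rewrite ler_pdivrMl// fl andbT.
  rewrite -(ler_pM2l n0) mulrBr mulVKf ?gt_eqF// divff ?gt_eqF//.
  by move: fr; rewrite intrD; lra.
- rewrite -[X in _ --> X]subr0; apply: cvgB; first exact: cvg_cst.
  exact: cvg_harmonic.
- exact: cvg_cst.
Qed.

Lemma cvg_sum_ord {R : realType} (n : nat) (f : 'I_n -> nat -> R) (l : 'I_n -> R) :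
  (forall i, f i k @[k --> \oo] --> l i) ->
  (\sum_i f i k) @[k --> \oo] --> \sum_i l i.
Proof.
move=> fl; elim: n f l fl => [|n IHn] f l fl.
  by under eq_fun do rewrite big_ord0; rewrite big_ord0; exact: cvg_cst.
under eq_fun do rewrite big_ord_recl; rewrite big_ord_recl.
by apply: cvgD; [exact: fl|apply: IHn].
Qed.

Lemma cvg_quadform {R : realType} {n : nat} (M : 'M[R]_n)
    (u : nat -> 'cV[R]_n) (x : 'cV[R]_n) :
  (forall i, u k i 0 @[k --> \oo] --> x i 0) ->
  quadform M (u k) @[k --> \oo] --> quadform M x.
Proof.
move=> ux; rewrite quadform_sum; under eq_fun do rewrite quadform_sum.
apply: cvg_sum_ord => i; apply: cvg_sum_ord => j.
by apply: cvgM => //; apply: cvgM => //; exact: cvg_cst.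
Qed.

(** By homogeneity the inequality at [floor (k x)] is the inequality at
[floor (k x) / k], and these points converge to [x]. *)
Lemma loewner_le_int {R : realType} {n : nat} (M M' : 'M[R]_n) :
  (forall v : 'cV[int]_n,
     quadform M (map_mx intr v) <= quadform M' (map_mx intr v)) ->
  loewner_le M M'.
Proof.
move=> leZ x; rewrite -subr_ge0 -quadformB.
pose v k : 'cV[int]_n := \col_i Num.floor (k.+1%:R * x i 0).
pose u k : 'cV[R]_n := (k.+1%:R)^-1 *: map_mx intr (v k).
have ux i : u k i 0 @[k --> \oo] --> x i 0.
  under eq_fun do rewrite !mxE.
  exact: cvg_floor_rescale.
have qux := @cvg_quadform _ _ (M' - M) _ _ ux.
rewrite -(cvg_lim _ qux)//.
apply: limr_ge; first by apply/cvg_ex; eexists; exact: qux.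
apply: nearW => k.
rewrite /u quadform_scale mulr_ge0 ?sqr_ge0//.
by rewrite quadformB subr_ge0.
Qed.

(** * The matrix exponential, entry by entry *)

(** A submultiplicative norm, hence a convenient bound for the entries of powers. *)
Definition entry_sum {R : realType} {N : nat} (M : 'M[R]_N) : R :=
  \sum_i \sum_j `|M i j|.

Lemma entry_sum_ge0 {R : realType} {N : nat} (M : 'M[R]_N) : 0 <= entry_sum M.
Proof. by apply: sumr_ge0 => i _; apply: sumr_ge0. Qed.

Lemma entry_sumZ {R : realType} {N : nat} (a : R) (M : 'M[R]_N) :
  entry_sum (a *: M) = `|a| * entry_sum M.
Proof.
rewrite /entry_sum mulr_sumr; apply: eq_bigr => i _.
by rewrite mulr_sumr; apply: eq_bigr => j _; rewrite mxE normrM.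
Qed.

Lemma scalemx_exp {R : realType} {N : nat} (a : R) (M : 'M[R]_N) k :
  (a *: M) ^+ k = a ^+ k *: M ^+ k.
Proof.
elim: k => [|k IHk]; first by rewrite !expr0 scale1r.
by rewrite !exprS IHk -!mulmxE -scalemxAl -scalemxAr scalerA.
Qed.

Lemma norm_exprmx_entry_le {R : realType} {N : nat} (M : 'M[R]_N) k i j :
  `|(M ^+ k) i j| <= entry_sum M ^+ k.
Proof.
elim: k i j => [|k IHk] i j.
  rewrite !expr0 mxE; case: eqP => _; first by rewrite normr1.
  by rewrite normr0.
rewrite !exprS mxE (le_trans (ler_norm_sum _ _ _))//.
apply: (@le_trans _ _ ((\sum_l `|M i l|) * entry_sum M ^+ k)).
  rewrite mulr_suml; apply: ler_sum => l _.
  by rewrite normrM ler_wpM2l.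
rewrite ler_wpM2r ?exprn_ge0 ?entry_sum_ge0//.
rewrite /entry_sum [leRHS](bigD1 i)//= lerDl.
by apply: sumr_ge0 => l _; apply: sumr_ge0.
Qed.

(** A matrix has finitely many entries, so entrywise convergence is uniform in the
entries. *)
Lemma cvg_mx {R : realType} {m n : nat} (u : nat -> 'M[R]_(m, n)) (L : 'M[R]_(m, n)) :
  (forall i j, u k i j @[k --> \oo] --> L i j) -> u @ \oo --> L.
Proof.
move=> uL; apply/cvg_mx_entourageP => A entA.
have : \forall k \near \oo, forall ij : 'I_m * 'I_n,
    (L ij.1 ij.2, u k ij.1 ij.2) \in A.
  apply: filter_forall => -[i j] /=.
  have /cvg_app_entourageP /(_ A entA) := uL i j.
  by apply: filterS => k ?; rewrite inE.
by apply: filterS => k Ak i j; exact: (Ak (i, j)).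
Qed.

(** The entries of the exponential series of [M] are dominated by the series of
[expR (entry_sum M)]; this bound is what makes [E] bounded on bounded sets of
times. *)
Lemma expmx_entry_series {R : realType} {N : nat} (M : 'M[R]_N) i j :
  cvgn (series (fun k => ((k`!%:R)^-1 *: M ^+ k) i j)) /\
  `|limn (series (fun k => ((k`!%:R)^-1 *: M ^+ k) i j))| <= expR (entry_sum M).
Proof.
set u := fun k => _.
have u_le k : `|u k| <= exp_coeff (entry_sum M) k.
  rewrite /u /exp_coeff /= mxE normrM normfV normr_nat mulrC.
  by rewrite ler_wpM2r ?invr_ge0// norm_exprmx_entry_le.
have u_ncvg : cvgn [normed series u].
  apply: (@series_le_cvg _ _ (exp_coeff (entry_sum M))) => //.
  - by move=> n; exact: normr_ge0.
  - by move=> n; exact: exp_coeff_ge0 (entry_sum_ge0 M).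
  - exact: is_cvg_series_exp_coeff.
split; first exact: normed_cvg.
apply: le_trans (lim_series_norm u_ncvg) _.
by apply: lim_series_le u_ncvg _ u_le; exact: is_cvg_series_exp_coeff.
Qed.

Lemma expmxE {R : realType} {N : nat} (M : 'M[R]_N) i j :
  expmx M i j = limn (series (fun k => ((k`!%:R)^-1 *: M ^+ k) i j)).
Proof.
pose L : 'M[R]_N :=
  \matrix_(i, j) limn (series (fun k => ((k`!%:R)^-1 *: M ^+ k) i j)).
have uL : series (fun k => (k`!%:R)^-1 *: M ^+ k) @ \oo --> L.
  apply: cvg_mx => {}i {}j; rewrite mxE.
  rewrite (_ : (fun k => _) = series (fun k => ((k`!%:R)^-1 *: M ^+ k) i j)).
    by case: (expmx_entry_series M i j).
  by apply/funext => k; rewrite /series /= summxE.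
rewrite /expmx (cvg_lim _ uL) ?mxE//.
Qed.

(** * Bounded measurable functions and matrices *)

(** On a set of finite measure these functions are integrable; unlike the integrable
functions they are stable under products, which the entries of a matrix product
require. *)
Definition bounded_measurable {d} {T : measurableType d} {R : realType} (D : set T)
    (f : T -> R) : Prop :=
  measurable_fun D f /\ exists K, forall s, D s -> `|f s| <= K.

Definition bounded_measurable_mx {d} {T : measurableType d} {R : realType} {m n : nat}
    (D : set T) (F : T -> 'M[R]_(m, n)) : Prop :=
  forall i j, bounded_measurable D (fun s => F s i j).

Lemma bounded_measurable_cst {d} {T : measurableType d} {R : realType}
    (D : set T) (c : R) :
  bounded_measurable D (fun=> c).
Proof. by split; [exact: measurable_cst|exists `|c|]. Qed.

Lemma bounded_measurableD {d} {T : measurableType d} {R : realType} (D : set T)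
    (f g : T -> R) :
  bounded_measurable D f -> bounded_measurable D g ->
  bounded_measurable D (fun s => f s + g s).
Proof.
move=> [mf [K fK]] [mg [L gL]]; split; first exact: measurable_funD.
exists (K + L) => s Ds; apply: le_trans (ler_normD _ _) _.
by rewrite lerD ?fK ?gL.
Qed.

Lemma bounded_measurableM {d} {T : measurableType d} {R : realType} (D : set T)
    (f g : T -> R) :
  bounded_measurable D f -> bounded_measurable D g ->
  bounded_measurable D (fun s => f s * g s).
Proof.
move=> [mf [K fK]] [mg [L gL]]; split; first exact: measurable_funM.
by exists (K * L) => s Ds; rewrite normrM ler_pM ?fK ?gL.
Qed.

Lemma bounded_measurable_sum {d} {T : measurableType d} {R : realType} (D : set T)
    (I : Type) (r : seq I) (f : I -> T -> R) :
  (forall i, bounded_measurable D (f i)) ->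
  bounded_measurable D (fun s => \sum_(i <- r) f i s).
Proof.
move=> bf; elim: r => [|i r IHr].
  by under eq_fun do rewrite big_nil; exact: bounded_measurable_cst.
by under eq_fun do rewrite big_cons; exact: bounded_measurableD.
Qed.

Lemma bounded_measurable_mx_mul {d} {T : measurableType d} {R : realType} {m n p : nat}
    (D : set T) (F : T -> 'M[R]_(m, n)) (G : T -> 'M[R]_(n, p)) :
  bounded_measurable_mx D F -> bounded_measurable_mx D G ->
  bounded_measurable_mx D (fun s => F s *m G s).
Proof.
move=> bF bG i j; under eq_fun do rewrite mxE.
by apply: bounded_measurable_sum => k; exact: bounded_measurableM.
Qed.

Lemma bounded_measurable_mx_tr {d} {T : measurableType d} {R : realType} {m n : nat}
    (D : set T) (F : T -> 'M[R]_(m, n)) :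
  bounded_measurable_mx D F -> bounded_measurable_mx D (fun s => (F s)^T).
Proof. by move=> bF i j; under eq_fun do rewrite mxE; exact: bF. Qed.

Lemma bounded_measurable_mx_extmx {d} {T : measurableType d} {R : realType} {q r : nat}
    (D : set T) (F : T -> 'M[R]_q) :
  bounded_measurable_mx D F -> bounded_measurable_mx D (fun s => extmx r (F s)).
Proof.
move=> bF i j; rewrite /extmx.
case: (split_ordP i) => {}i ->; case: (split_ordP j) => {}j ->.
- by under eq_fun do rewrite block_mxEul; exact: bF.
- by under eq_fun do rewrite block_mxEur mxE; exact: bounded_measurable_cst.
- by under eq_fun do rewrite block_mxEdl mxE; exact: bounded_measurable_cst.
- by under eq_fun do rewrite block_mxEdr mxE; exact: bounded_measurable_cst.
Qed.

Lemma bounded_measurable_integrable {d} {T : measurableType d} {R : realType}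
    (mu : {measure set T -> \bar R}) (D : set T) (f : T -> R) :
  measurable D -> (mu D < +oo)%E -> bounded_measurable D f ->
  mu.-integrable D (EFin \o f).
Proof.
move=> mD muD [mf [K fK]]; apply: measurable_bounded_integrable => //.
exists K; split; [exact: num_real|move=> M KM s Ds].
by apply: le_trans (fK _ Ds) (ltW KM).
Qed.

(** The difference [g - f] equals its absolute value almost everywhere. *)
Lemma ae_le_Rintegral {d} {T : measurableType d} {R : realType}
    (mu : {measure set T -> \bar R}) (D : set T) (f g : T -> R) :
  measurable D -> mu.-integrable D (EFin \o f) -> mu.-integrable D (EFin \o g) ->
  {ae mu, forall s, D s -> f s <= g s} ->
  \int[mu]_(s in D) f s <= \int[mu]_(s in D) g s.
Proof.
move=> mD intf intg fg; rewrite -subr_ge0 -RintegralB//.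
have mgf : measurable_fun D (fun s => g s - f s).
  apply: measurable_funB; apply/measurable_EFinP.
    by case/integrableP : intg.
  by case/integrableP : intf.
rewrite (_ : Rintegral _ _ _ = \int[mu]_(s in D) `|g s - f s|).
  exact: Rintegral_ge0.
congr fine; apply: ae_eq_integral => //.
- exact/measurable_EFinP.
- by apply/measurable_EFinP; exact: measurableT_comp.
- apply: filterS fg => s /= fg Ds.
  by rewrite ger0_norm// subr_ge0 fg.
Qed.

Lemma bounded_measurable_Emx {d} {T : measurableType d} {R : realType}
    {N : nat} (D : set T) (B : 'M[R]_N) (f : T -> R) :
  bounded_measurable D f -> bounded_measurable_mx D (fun s => Emx B (f s)).
Proof.
move=> [mf [K fK]] i j; rewrite /Emx; split.
  (* the partial sums are polynomials in [f s] *)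
  pose h n s := series (fun k => ((k`!%:R)^-1 *: (- f s *: B) ^+ k) i j) n.
  apply: (@measurable_fun_cvg _ _ _ D h).
    move=> n; rewrite /h /series /=; apply: measurable_sum => k.
    under eq_fun do rewrite scalemx_exp !mxE.
    apply: measurable_funM; first exact: measurable_cst.
    apply: measurable_funM; last exact: measurable_cst.
    by apply: measurable_funX; exact: measurable_funN.
  move=> s Ds; rewrite expmxE /h.
  by have [] := expmx_entry_series (- f s *: B) i j.
exists (expR (K * entry_sum B)) => s Ds; rewrite expmxE.
have [_ /le_trans] := expmx_entry_series (- f s *: B) i j; apply.
by rewrite ler_expR entry_sumZ normrN ler_wpM2r ?fK ?entry_sum_ge0.
Qed.

(** * Integration of bounded measurable matrices *)

Lemma Rintegral_sum {d} {T : measurableType d} {R : realType}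
    (mu : {measure set T -> \bar R}) (D : set T) (I : Type) (r : seq I)
    (f : I -> T -> R) :
  measurable D -> (mu D < +oo)%E -> (forall i, bounded_measurable D (f i)) ->
  \int[mu]_(s in D) (\sum_(i <- r) f i s) = \sum_(i <- r) \int[mu]_(s in D) f i s.
Proof.
move=> mD muD bf; elim: r => [|i r IHr].
  rewrite big_nil; under eq_Rintegral do rewrite big_nil.
  by rewrite /Rintegral integral0.
rewrite big_cons -IHr -RintegralD//.
- by apply: eq_Rintegral => s _; rewrite big_cons.
- exact: bounded_measurable_integrable.
- by apply: bounded_measurable_integrable => //; exact: bounded_measurable_sum.
Qed.

Lemma bounded_measurable_quadform {d} {T : measurableType d} {R : realType} {n : nat}
    (D : set T) (F : T -> 'M[R]_n) (x : 'cV[R]_n) :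
  bounded_measurable_mx D F -> bounded_measurable D (fun s => quadform (F s) x).
Proof.
move=> bF; under eq_fun do rewrite quadform_sum.
apply: bounded_measurable_sum => i; apply: bounded_measurable_sum => j.
apply: bounded_measurableM; [apply: bounded_measurableM|].
- exact: bF.
- exact: bounded_measurable_cst.
- exact: bounded_measurable_cst.
Qed.

(** [integralmx] is the instance of the completed Lebesgue measure; the algebra of
these integrals does not depend on the measure. *)
Definition Rintegralmx {d} {T : measurableType d} {R : realType} {m n : nat}
    (mu : {measure set T -> \bar R}) (D : set T) (F : T -> 'M[R]_(m, n)) :
    'M[R]_(m, n) :=
  \matrix_(i, j) \int[mu]_(s in D) F s i j.

Section integral_of_matrices.
Context {d} {T : measurableType d} {R : realType} {n : nat}.
Variables (mu : {measure set T -> \bar R}) (D : set T).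
Hypotheses (mD : measurable D) (muD : (mu D < +oo)%E).
Implicit Types F G : T -> 'M[R]_n.

(** The form at a fixed vector is linear in the entries of the matrix. *)
Lemma quadform_Rintegralmx F (x : 'cV[R]_n) : bounded_measurable_mx D F ->
  quadform (Rintegralmx mu D F) x = \int[mu]_(s in D) quadform (F s) x.
Proof.
move=> bF; rewrite quadform_sum.
under eq_Rintegral do rewrite quadform_sum.
rewrite Rintegral_sum//; last first.
  move=> i; apply: bounded_measurable_sum => j.
  by apply: bounded_measurableM; [apply: bounded_measurableM|];
    [exact: bF|exact: bounded_measurable_cst..].
apply: eq_bigr => i _; rewrite Rintegral_sum//; last first.
  by move=> j; apply: bounded_measurableM; [apply: bounded_measurableM|];
    [exact: bF|exact: bounded_measurable_cst..].
apply: eq_bigr => j _; rewrite mxE -mulrA mulrC -RintegralZl//; last first.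
  exact: bounded_measurable_integrable.
by apply: eq_Rintegral => s _; ring.
Qed.

Lemma loewner_le_Rintegralmx F G :
  bounded_measurable_mx D F -> bounded_measurable_mx D G ->
  {ae mu, forall s, D s -> loewner_le (F s) (G s)} ->
  loewner_le (Rintegralmx mu D F) (Rintegralmx mu D G).
Proof.
move=> bF bG FG x; rewrite !quadform_Rintegralmx//.
apply: ae_le_Rintegral => //.
- by apply: bounded_measurable_integrable => //; exact: bounded_measurable_quadform.
- by apply: bounded_measurable_integrable => //; exact: bounded_measurable_quadform.
- by apply: filterS FG => s FGs Ds; exact: FGs.
Qed.

Lemma RintegralmxZ (a : R) F : bounded_measurable_mx D F ->
  Rintegralmx mu D (fun s => a *: F s) = a *: Rintegralmx mu D F.
Proof.
move=> bF; apply/matrixP => i j; rewrite !mxE -RintegralZl//.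
  by apply: eq_Rintegral => s _; rewrite mxE.
exact: bounded_measurable_integrable.
Qed.

Lemma tr_Rintegralmx F :
  (forall s, (F s)^T = F s) -> (Rintegralmx mu D F)^T = Rintegralmx mu D F.
Proof.
move=> FT; apply/matrixP => i j; rewrite !mxE; apply: eq_Rintegral => s _.
by rewrite -[in LHS]FT mxE.
Qed.

End integral_of_matrices.

(** * The completed Lebesgue measure under translations *)

Lemma measurable_id_lebesgueR {R : realType} (D : set (lebesgueR R)) :
  measurable_fun D (fun s : lebesgueR R => s : measurableTypeR R).
Proof.
apply: measurable_funTS => _ Y mY.
by rewrite setTI; apply: sub_caratheodory; exact: mY.
Qed.

Lemma measurable_translation {R : realType} (a : R) :
  measurable_fun [set: lebesgueR R]
    (fun s : lebesgueR R => s - a : measurableTypeR R).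
Proof.
apply: measurable_funB; last exact: measurable_cst.
exact: measurable_id_lebesgueR.
Qed.

(** Both sides are measures on the Borel sets with the same values on the half-open
intervals. *)
Lemma pushforward_translation {R : realType} (a : R)
    (A : set (measurableTypeR R)) : measurable A ->
  pushforward (@completed_lebesgue_measure R)
    (fun s : lebesgueR R => s - a : measurableTypeR R) A
  = lebesgue_measure A.
Proof.
pose phi (s : lebesgueR R) : measurableTypeR R := s - a.
move=> mA; apply/esym.
pose mphi := [the {mfun lebesgueR R >-> measurableTypeR R} of
  mfun_Sub (mem_set (measurable_translation a))].
apply: (@lebesgue_measure_unique R
  (pushforward (@completed_lebesgue_measure R) mphi)) => //.
move=> _ [[u v]] _ <-.
rewrite [RHS](_ : _ = lebesgue_measure `]u + a, v + a]%classic).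
  rewrite !lebesgue_measure_itv/= !lte_fin ltrD2r.
  by case: ifP => // _; rewrite -!EFinB; congr EFin; ring.
rewrite /pushforward -[RHS]/(completed_lebesgue_measure _).
congr (completed_lebesgue_measure _).
apply/seteqP; split => s /=; rewrite !in_itv /= /phi; lra.
Qed.

Lemma measurable_itv_lebesgueR {R : realType} (i : interval R) :
  measurable ([set` i] : set (lebesgueR R)).
Proof. by apply: sub_caratheodory; exact: measurable_itv. Qed.

Lemma completed_itv_lty {R : realType} (a b : R) :
  (completed_lebesgue_measure (`[a, b]%classic : set (lebesgueR R)) < +oo)%E.
Proof.
rewrite -[X in (X < _)%E]/(lebesgue_measure `[a, b]%classic).
rewrite lebesgue_measure_itv/=.
by case: ifP => _; rewrite ?ltry// -EFinB ltry.
Qed.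

Lemma bounded_measurable_cstB {d} {T : measurableType d} {R : realType}
    (t a b : R) (f : T -> R) (D : set T) :
  measurable_fun D f -> (forall s, D s -> a <= f s <= b) ->
  bounded_measurable D (fun s => t - f s).
Proof.
move=> mf fab; split.
  by apply: measurable_funB => //; exact: measurable_cst.
exists (`|t| + (`|a| + `|b|)) => s /fab /andP[af fb].
apply: le_trans (ler_normB _ _) _; rewrite lerD2l ler_norml.
have := ler_norm b; have := ler_norm (- a); rewrite normrN.
have := normr_ge0 a; have := normr_ge0 b; lra.
Qed.

(** Instances with different [a] have the same right-hand side, so that the integral
is invariant under translation; the Borel measure serves as an intermediate
because the uniqueness of Lebesgue measure is a statement on Borel sets. *)
Lemma Rintegral_translation {R : realType} (a : R)
    (D : set (measurableTypeR R)) (g : R -> R) :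
  measurable D -> (lebesgue_measure D < +oo)%E -> bounded_measurable D g ->
  \int[completed_lebesgue_measure]_(s in
      (fun s : lebesgueR R => s - a : measurableTypeR R) @^-1` D) g (s - a)
  = \int[lebesgue_measure]_(s in D) g s.
Proof.
move=> mD muD [mg [K gK]].
pose phi (s : lebesgueR R) : measurableTypeR R := s - a.
have mphi : measurable_fun setT phi := measurable_translation a.
(* Extending [g] by [0] outside [D] gives a function measurable on the whole line,
   as the image-measure formula requires. *)
pose f : measurableTypeR R -> \bar R := EFin \o (g \_ D).
have mf : measurable_fun setT f.
  by apply/measurable_EFinP; exact: (iffLR (measurable_restrictT g mD)).
have mphiD : measurable (phi @^-1` D) by rewrite -[X in measurable X]setTI; exact: mphi.
have fE s : D s -> f s = (g s)%:E by move=> Ds; rewrite /f /= patchT// inE.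
rewrite /Rintegral; congr fine.
transitivity (\int[completed_lebesgue_measure]_(s in phi @^-1` D) (f \o phi) s)%E.
  by apply: eq_integral => s; rewrite inE => Ds; rewrite /= fE.
rewrite -integral_pushforward//.
  apply: (etrans (eq_measure_integral lebesgue_measure _)).
    by move=> A mA _; exact: pushforward_translation.
  by apply: eq_integral => s; rewrite inE => Ds; rewrite fE.
apply: measurable_bounded_integrable.
- exact: mphiD.
- by rewrite -[X in (X < _)%E]/(pushforward _ phi D) pushforward_translation.
- by apply: measurable_funTS; apply: measurableT_comp mphi; apply/measurable_EFinP.
- exists K; split; [exact: num_real|move=> M KM s Ds].
  rewrite /= patchT ?inE//.
  by apply: le_trans (gK _ Ds) (ltW KM).
Qed.

(** * Comparison of the covariance matrices *)

Lemma ae_forall_countable {d} {T : measurableType d} {R : realType}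
    (mu : {measure set T -> \bar R}) (I : countType) (P : I -> T -> Prop) :
  (forall i, {ae mu, forall s, P i s}) -> {ae mu, forall s, forall i, P i s}.
Proof.
move=> aeP.
pose Q n s := forall i, unpickle n = Some i -> P i s.
have : {ae mu, forall s, forall n, Q n s}.
  apply: ae_foralln => n; rewrite /Q; case: (unpickle n) => [i|]; last first.
    exact: aeW.
  by apply: filterS (aeP i) => s Ps _ [<-].
by apply: filterS => s Qs i; apply: (Qs (pickle i)); rewrite pickleK.
Qed.

(** The null set is the union of the null sets attached to the integer vectors. *)
Lemma elliptic_coeffs_loewner {R : realType} {q : nat} (nu : R)
    (A0 : R -> 'M[R]_q) : elliptic_coeffs nu A0 ->
  {ae completed_lebesgue_measure, forall t : lebesgueR R,
    loewner_le (nu *: 1%:M) (A0 t) /\ loewner_le (A0 t) (nu^-1 *: 1%:M)}.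
Proof.
move=> [_ _ _ _ ell].
have quadform1 (x : 'cV[R]_q) : quadform 1%:M x = \sum_i x i 0 ^+ 2.
  by rewrite /quadform mulmx1 mxE; apply: eq_bigr => i _; rewrite mxE expr2.
have := ae_forall_countable (fun v : 'cV[int]_q => ell (map_mx intr v)).
apply: filterS => t ellt; split; apply: loewner_le_int => v;
  rewrite quadformZ quadform1 quadform_sum;
  by case/andP: (ellt v).
Qed.

Lemma bounded_measurable_mx_congr {d} {T : measurableType d} {R : realType}
    {q r : nat} (D : set T) (B : 'M[R]_(q + r)) (f : T -> R) (A : T -> 'M[R]_q) :
  bounded_measurable D f -> bounded_measurable_mx D A ->
  bounded_measurable_mx D (fun s => Emx B (f s) *m extmx r (A s) *m (Emx B (f s))^T).
Proof.
move=> bf bA; have bE := bounded_measurable_Emx B bf.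
apply: bounded_measurable_mx_mul; last exact: bounded_measurable_mx_tr.
by apply: bounded_measurable_mx_mul => //; exact: bounded_measurable_mx_extmx.
Qed.

Lemma integralmxE {R : realType} {m n : nat} (D : set (lebesgueR R))
    (F : R -> 'M[R]_(m, n)) i j :
  integralmx D F i j = \int[completed_lebesgue_measure]_(s in D) F s i j.
Proof. by rewrite mxE. Qed.

(** Substituting [s - t0] for [s] turns the time interval from [0] to [t - t0] into
that from [t0] to [t]; from here on the model matrix is treated as the case [A0 = 1]. *)
Lemma C0mxE {R : realType} {q r : nat} (B : 'M[R]_(q + r))
    (t t0 : R) : C0mx B (t - t0) = Cmx (fun=> 1%:M) B t t0.
Proof.
pose F s := Emx B (t - t0 - s) *m extmx r (1%:M : 'M[R]_q) *m (Emx B (t - t0 - s))^T.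
apply/matrixP => i j; rewrite [LHS]integralmxE [RHS]integralmxE.
pose D : set (measurableTypeR R) := `[0, t - t0]%classic.
have mD : measurable D by exact: measurable_itv.
have muD : (lebesgue_measure D < +oo)%E by exact: completed_itv_lty.
have bg : bounded_measurable D (fun s => F s i j).
  apply: bounded_measurable_mx_congr; last first.
    by move=> k l; exact: bounded_measurable_cst.
  apply: (@bounded_measurable_cstB _ _ _ _ 0 (t - t0)); first exact: measurable_id.
  by move=> s; rewrite /D /= in_itv.
transitivity (\int[lebesgue_measure]_(s in D) F s i j).
  rewrite -(Rintegral_translation 0 mD muD bg).
  have -> : (fun s : lebesgueR R => s - 0 : measurableTypeR R) @^-1` D
      = `[0, t - t0]%classic.
    by apply/seteqP; split => s; rewrite /D /= subr0.
  by apply: eq_Rintegral => s _; rewrite subr0.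
rewrite -(Rintegral_translation t0 mD muD bg).
have -> : (fun s : lebesgueR R => s - t0 : measurableTypeR R) @^-1` D
    = `[t0, t]%classic.
  by apply/seteqP; split => s; rewrite /D /= !in_itv /= => /andP[? ?];
    apply/andP; split; lra.
apply: eq_Rintegral => s _; rewrite /F.
by have -> : t - t0 - (s - t0) = t - s by ring.
Qed.

Lemma loewner_le_Cmx {R : realType} {q r : nat} (nu : R) (A0 : R -> 'M[R]_q)
    (B : 'M[R]_(q + r)) (t t0 : R) : elliptic_coeffs nu A0 ->
  loewner_le (nu *: C0mx B (t - t0)) (Cmx A0 B t t0) /\
  loewner_le (Cmx A0 B t t0) (nu^-1 *: C0mx B (t - t0)).
Proof.
move=> ell; have ae_ell := elliptic_coeffs_loewner ell.
case: ell => [_ mA [K AK] _ _].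
pose D : set (lebesgueR R) := `[t0, t]%classic.
have mD : measurable D by exact: measurable_itv_lebesgueR.
have muD : (completed_lebesgue_measure D < +oo)%E by exact: completed_itv_lty.
have bf : bounded_measurable D (fun s => t - s).
  apply: (@bounded_measurable_cstB _ _ _ _ t0 t); first exact: measurable_id_lebesgueR.
  by move=> s; rewrite /D /= in_itv.
have bA : bounded_measurable_mx D (A0 : lebesgueR R -> _).
  by move=> i j; split; [exact: measurable_funTS|exists K => s _; exact: AK].
have b1 : bounded_measurable_mx D (fun=> 1%:M : 'M[R]_q).
  by move=> i j; exact: bounded_measurable_cst.
have bFA := bounded_measurable_mx_congr B bf bA.
have bF1 := bounded_measurable_mx_congr B bf b1.
have bZ a : bounded_measurable_mx D (fun s =>
    a *: (Emx B (t - s) *m extmx r (1%:M : 'M[R]_q) *m (Emx B (t - s))^T)).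
  move=> i j; under eq_fun do rewrite mxE.
  by apply: bounded_measurableM; [exact: bounded_measurable_cst|exact: bF1].
rewrite C0mxE -[Cmx (fun=> _) _ _ _]/(Rintegralmx _ D _).
rewrite -!(RintegralmxZ mD muD _ bF1).
split; [apply: (loewner_le_Rintegralmx mD muD (bZ _) bFA)
       |apply: (loewner_le_Rintegralmx mD muD bFA (bZ _))];
  apply: filterS ae_ell => s [l1 l2] _ x.
  by rewrite quadformZ !quadform_congr !quadform_extmx -quadformZ.
by rewrite quadformZ !quadform_congr !quadform_extmx -quadformZ.
Qed.

Lemma Cmx_sym {R : realType} {q r : nat} (A0 : R -> 'M[R]_q)
    (B : 'M[R]_(q + r)) (t t0 : R) : (forall s, (A0 s)^T = A0 s) ->
  (Cmx A0 B t t0)^T = Cmx A0 B t t0.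
Proof.
move=> AT; apply: tr_Rintegralmx => s.
by rewrite !trmx_mul trmxK /extmx tr_block_mx AT !trmx0 mulmxA.
Qed.

Lemma psd_C0mx {R : realType} {q r : nat} (B : 'M[R]_(q + r)) (t : R) :
  psdmx (C0mx B t).
Proof.
pose D : set (lebesgueR R) := `[0, t]%classic.
have mD : measurable D by exact: measurable_itv_lebesgueR.
have muD : (completed_lebesgue_measure D < +oo)%E by exact: completed_itv_lty.
have bf : bounded_measurable D (fun s => t - s).
  apply: (@bounded_measurable_cstB _ _ _ _ 0 t); first exact: measurable_id_lebesgueR.
  by move=> s; rewrite /D /= in_itv.
have b1 : bounded_measurable_mx D (fun=> 1%:M : 'M[R]_q).
  by move=> i j; exact: bounded_measurable_cst.
move=> x; rewrite (quadform_Rintegralmx mD muD x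
  (bounded_measurable_mx_congr B bf b1)).
apply: Rintegral_ge0 => s _.
by rewrite quadform_congr quadform_extmx quadform1_ge0.
Qed.

(** * Comparison of the Gaussian kernels *)

Lemma sqrt_exp_half {R : realType} (a : R) (n : nat) : 0 < a ->
  Num.sqrt (a ^+ n) = a `^ (n%:R / 2).
Proof.
move=> a0; apply/eqP; rewrite -(eqrXn2 (n := 2)) ?sqrtr_ge0 ?powR_ge0//.
rewrite sqr_sqrtr ?exprn_ge0 ?ltW//.
rewrite -[X in _ == X](powR_mulrn 2) ?powR_ge0//.
by rewrite -powRrM divfK// powR_mulrn// ltW.
Qed.

(** Here [a] is the ellipticity constant and [tau] stands for [(t - t0) Tr B], which
is common to the three kernels. *)
Lemma gaussian_le {R : realType} {n : nat} (a tau : R) (C C0 : 'M[R]_n)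
    (y : 'cV[R]_n) : 0 < a ->
  C^T = C -> C0^T = C0 -> psdmx C0 ->
  loewner_le (a *: C0) C -> loewner_le C (a^-1 *: C0) ->
  a ^+ n * (1 / ((4 * pi * a) `^ (n%:R / 2) * Num.sqrt (\det C0))
    * expR (- (1 / (4 * a)) * quadform (invmx C0) y - tau))
  <= 1 / ((4 * pi) `^ (n%:R / 2) * Num.sqrt (\det C))
    * expR (- (1 / 4) * quadform (invmx C) y - tau)
  /\
  1 / ((4 * pi) `^ (n%:R / 2) * Num.sqrt (\det C))
    * expR (- (1 / 4) * quadform (invmx C) y - tau)
  <= 1 / a ^+ n * (1 / ((4 * pi * a^-1) `^ (n%:R / 2) * Num.sqrt (\det C0))
    * expR (- (1 / (4 * a^-1)) * quadform (invmx C0) y - tau)).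
Proof.
move=> a0 CT C0T C00 leC geC.
have ia0 : 0 < a^-1 by rewrite invr_gt0.
have scale0 (b : R) : 0 < b -> psdmx (b *: C0).
  by move=> b0 x; rewrite quadformZ mulr_ge0 ?C00 ?(ltW b0).
have scaleT (b : R) : (b *: C0)^T = b *: C0 by rewrite linearZ /= C0T.
have Cpsd := psdmx_le (scale0 a a0) leC.
have /andP[_ dl] := det_loewner (scaleT a) CT (scale0 a a0) leC.
have /andP[dC0 dr] := det_loewner CT (scaleT a^-1) Cpsd geC.
rewrite !detZ in dl dr.
have /andP[d0 _] := det_loewner C0T C0T C00 (fun=> lexx _).
have pi40 : 0 < 4 * pi :> R by rewrite mulr_gt0// pi_gt0.
have splitpow (b : R) : 0 < b -> (4 * pi * b) `^ (n%:R / 2)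
    = (4 * pi) `^ (n%:R / 2) * Num.sqrt (b ^+ n).
  by move=> b0; rewrite sqrt_exp_half// powRM//; exact: ltW.
rewrite !splitpow//.
(* In the degenerate case the comparison gives [det C0 = 0] as well, and all the
   prefactors are [1 / 0 = 0]. *)
have [dCE|dCN] := eqVneq (\det C) 0.
  have d0E : \det C0 = 0.
    apply/le_anti; rewrite d0 andbT.
    by move: dl; rewrite dCE pmulr_rle0 ?exprn_gt0.
  by rewrite dCE d0E sqrtr0 !mulr0 !invr0 !mulr0 !mul0r !mulr0.
have dC : 0 < \det C by rewrite lt_neqAle eq_sym dCN.
have d0p : 0 < \det C0.
  by move: (lt_le_trans dC dr); rewrite pmulr_rgt0 ?exprn_gt0.
have uC : C \in unitmx by rewrite unitmxE unitfE gt_eqF.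
have uC0 : C0 \in unitmx by rewrite unitmxE unitfE gt_eqF.
have uZ (b : R) : 0 < b -> b *: C0 \in unitmx.
  by move=> b0; rewrite unitmxE unitfE detZ mulf_neq0 ?gt_eqF ?exprn_gt0.
have invZ (b : R) : 0 < b -> invmx (b *: C0) = b^-1 *: invmx C0.
  by move=> b0; rewrite invmxZ// uZ.
have ql := quadform_invmx_le (scaleT a) CT (uZ a a0) uC (scale0 a a0) leC y.
have qr := quadform_invmx_le CT (scaleT a^-1) uC (uZ a^-1 ia0) Cpsd geC y.
rewrite !invZ// invrK !quadformZ in ql qr.
set P := (4 * pi) `^ _; have P0 : 0 < P by exact: powR_gt0.
set S := Num.sqrt (a ^+ n); have S0 : 0 < S by rewrite sqrtr_gt0 exprn_gt0.
have SS : a ^+ n = S ^+ 2 by rewrite sqr_sqrtr// exprn_ge0// ltW.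
have iS : Num.sqrt (a^-1 ^+ n) = S^-1 by rewrite exprVn sqrtrV// exprn_ge0// ltW.
set X := Num.sqrt (\det C); have X0 : 0 < X by rewrite sqrtr_gt0.
set Y := Num.sqrt (\det C0); have Y0 : 0 < Y by rewrite sqrtr_gt0.
have SX : S * Y <= X.
  by rewrite -sqrtrM ?(exprn_ge0 n (ltW a0))//; exact: ler_wsqrtr.
have XS : X <= S^-1 * Y.
  by rewrite -iS -sqrtrM ?(exprn_ge0 n (ltW ia0))//; exact: ler_wsqrtr.
rewrite iS SS; split.
- rewrite mulrA ler_pM ?expR_ge0//.
  + by rewrite mulr_ge0 ?sqr_ge0// divr_ge0// !mulr_ge0 ?ltW.
  + have -> : S ^+ 2 * (1 / (P * S * Y)) = 1 / (P * (S^-1 * Y)).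
      by field; rewrite !gt_eqF.
    by rewrite ler_pM2l// lef_pV2 ?posrE ?mulr_gt0 ?invr_gt0// ler_pM2l.
  + rewrite ler_expR lerD2r.
    have -> : 1 / (4 * a) = 1 / 4 * a^-1 by field; rewrite gt_eqF.
    lra.
- rewrite [leRHS]mulrA ler_pM ?expR_ge0//.
  + by rewrite divr_ge0// !mulr_ge0 ?ltW.
  + have -> : 1 / S ^+ 2 * (1 / (P * S^-1 * Y)) = 1 / (P * (S * Y)).
      by field; rewrite !gt_eqF.
    by rewrite ler_pM2l// lef_pV2 ?posrE ?mulr_gt0// ler_pM2l.
  + rewrite ler_expR lerD2r.
    have -> : 1 / (4 * a^-1) = 1 / 4 * a by field; rewrite gt_eqF.
    lra.
Qed.

Theorem theorem1p7 (R : realType) (q r : nat) (nu : R) (A0 : R -> 'M[R]_q)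
    (B : 'M[R]_(q + r)) (hq : (1 <= q)%N) (h1 : elliptic_coeffs nu A0) (h2 : block_structure q B)
    (t t0 : R) (htt0 : t0 < t) (x x0 : 'cV[R]_(q + r)) :
  nu ^+ (q + r) * Gamma_alpha nu B x t x0 t0 <= Gamma A0 B x t x0 t0 /\
  Gamma A0 B x t x0 t0 <= 1 / nu ^+ (q + r) * Gamma_alpha nu^-1 B x t x0 t0.
Proof.
have [leC geC] := loewner_le_Cmx B t t0 h1.
have [AT _ _ nu0 _] := h1.
have CT : (Cmx A0 B t t0)^T = Cmx A0 B t t0 := Cmx_sym B t t0 AT.
have C0T : (C0mx B (t - t0))^T = C0mx B (t - t0).
  by rewrite C0mxE; apply: Cmx_sym => s; exact: tr_scalar_mx.
rewrite /Gamma_alpha /Gamma_alpha0 /Gamma.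
exact (gaussian_le ((t - t0) * \tr B) (x - Emx B (t - t0) *m x0)
  nu0 CT C0T (psd_C0mx B (t - t0)) leC geC).
Qed.
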